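(* Let $K$ be a field. For every positive integer $k$: (1) there exist infinitely many connected bipartite graphs $\mathcal H_k$ with cover ideal $J(\mathcal H_k)$ such that $\operatorname{reg}(S/J(\mathcal H_k))-v(J(\mathcal H_k))=k$, where $S$ is the polynomial ring over the field $K$ with $|V(\mathcal H_k)|$ variables; (2) there exists a connected non-bipartite graph $\mathcal H_k$ with cover ideal $J(\mathcal H_k)$ such that $\operatorname{reg}(S/J(\mathcal H_k))-v(J(\mathcal H_k))=k$, where $S$ is the polynomial ring over the field $K$ with $|V(\mathcal H_k)|$ variables.
   Context: Graphs are finite and simple, with vertex set of the form $\{1,\ldots,u\}$ and edge set $E(G)$. The cover ideal of $G$ is $J(G)=\bigcap_{(i,j)\in E(G)}\langle x_i,x_j\rangle\subset S=K[x_1,\ldots,x_u]$, with $S$ standard graded. For a homogeneous ideal $I$ of an $\mathbb N$-graded Noetherian ring $S=\bigoplus_n S_n$, the $v$-number is $v(I)=\min\{u:\text{there exist } f\in S_u\text{ and }\mathfrak p\in\operatorname{Ass}(S/I)\text{ with }\mathfrak p=(I:f)\}$. For a finitely generated graded $S$-module $M$ with minimal graded free resolution having $i$-th term $\bigoplus_jS(-j)^{\beta_{ij}}$, the Castelnuovo–Mumford regularity is $\operatorname{reg}(M)=\max\{j-i:\beta_{ij}\ne0\}$. *)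

(* Defs.v *)
From HB Require Import structures.
From mathcomp Require Import all_boot all_order all_algebra.
From mathcomp Require Import generic_quotient ring_quotient.
From mathcomp Require Import boolp.
From mathcomp Require Import mpoly.

Set Implicit Arguments.
Unset Strict Implicit.
Unset Printing Implicit Defensive.

Import GRing.Theory.

Local Open Scope ring_scope.
Local Open Scope quotient_scope.

Record sgraph := SGraph {
  nvert : nat;
  adj : rel 'I_nvert;
  adj_sym : forall x y, adj x y = adj y x;
  adj_irr : forall x, ~~ adj x x
}.

Definition sg_connected (G : sgraph) : Prop :=
  (0 < nvert G)%N /\ forall x y : 'I_(nvert G), connect (@adj G) x y.

Definition sg_bipartite (G : sgraph) : Prop :=
  exists A : {set 'I_(nvert G)},
    forall x y, adj x y -> (x \in A) != (y \in A).

Definition sg_iso (G H : sgraph) : Prop :=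
  exists f : 'I_(nvert G) -> 'I_(nvert H),
    bijective f /\ forall x y, adj (f x) (f y) = adj x y.

(* The additive group V / N comes from ring_quotient; the scalar multiplication
   is added here.  N need not be proper, so the zero module is covered. *)
Section QuotientModule.
Variables (R : nzRingType) (V : lmodType R) (N : submodClosed V).

(* mathcomp's submodClosed does not inherit from zmodClosed. *)
Definition submod_pred : {pred V} := [pred x | x \in N].

Lemma submod_pred_zmod_closed : zmod_closed submod_pred.
Proof.
split=> [|x y xN yN]; first exact: (rpred0 N).
by rewrite inE (rpredD (S := N)) // -scaleN1r rpredZ.
Qed.

HB.instance Definition _ :=
  GRing.isZmodClosed.Build V submod_pred submod_pred_zmod_closed.

Definition quotmod : Type := Quotient.quot submod_pred.

HB.instance Definition _ := GRing.Zmodule.on quotmod.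

Definition quotmod_pi (x : V) : quotmod := \pi_(Quotient.quot submod_pred) x.

Definition quotmod_scale (a : R) (x : quotmod) : quotmod :=
  quotmod_pi (a *: repr (x : Quotient.quot submod_pred)).

Lemma quotmod_piE x y : (quotmod_pi x == quotmod_pi y) = (x - y \in N).
Proof. by rewrite -(Quotient.idealrBE submod_pred). Qed.

Lemma quotmod_pi_surj (x : quotmod) : exists v, quotmod_pi v = x.
Proof. by exists (repr (x : Quotient.quot submod_pred)); rewrite /quotmod_pi reprK. Qed.

Lemma quotmod_piB : {morph quotmod_pi : x y / x - y}.
Proof. by move=> x y; rewrite /quotmod_pi raddfB. Qed.

Lemma quotmod_piD : {morph quotmod_pi : x y / x + y}.
Proof. by move=> x y; rewrite /quotmod_pi raddfD. Qed.

Lemma quotmod_scale_pi a x :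
  quotmod_scale a (quotmod_pi x) = quotmod_pi (a *: x).
Proof.
apply/eqP; rewrite quotmod_piE -scalerBr rpredZ // -quotmod_piE.
by rewrite /quotmod_pi reprK.
Qed.

Lemma quotmod_scaleA a b x :
  quotmod_scale a (quotmod_scale b x) = quotmod_scale (a * b) x.
Proof.
by case: (quotmod_pi_surj x) => v <-; rewrite !quotmod_scale_pi scalerA.
Qed.

Lemma quotmod_scale1 : left_id 1 quotmod_scale.
Proof.
by move=> x; case: (quotmod_pi_surj x) => v <-;
   rewrite quotmod_scale_pi scale1r.
Qed.

Lemma quotmod_scaleDr : right_distributive quotmod_scale +%R.
Proof.
move=> a x y; case: (quotmod_pi_surj x) => v <-.
case: (quotmod_pi_surj y) => w <-.
by rewrite -quotmod_piD !quotmod_scale_pi scalerDr quotmod_piD.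
Qed.

Lemma quotmod_scaleDl v :
  {morph quotmod_scale^~ v : a b / a + b}.
Proof.
move=> a b; case: (quotmod_pi_surj v) => w <-.
by rewrite !quotmod_scale_pi scalerDl quotmod_piD.
Qed.

HB.instance Definition _ := GRing.Zmodule_isLmodule.Build R quotmod
  quotmod_scaleA quotmod_scale1 quotmod_scaleDr quotmod_scaleDl.

Lemma quotmod_pi_zmod_morphism : zmod_morphism quotmod_pi.
Proof. exact: quotmod_piB. Qed.

Lemma quotmod_pi_scalable : scalable quotmod_pi.
Proof. by move=> a x; rewrite -quotmod_scale_pi. Qed.

HB.instance Definition _ :=
  GRing.isZmodMorphism.Build V quotmod quotmod_pi quotmod_pi_zmod_morphism.
HB.instance Definition _ :=
  GRing.isScalable.Build R V quotmod *:%R quotmod_pi quotmod_pi_scalable.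

End QuotientModule.

(* mathcomp's [idealr_closed] includes properness. *)
Definition associated_prime (R : comNzRingType) (M : lmodType R)
    (p : {pred R}) : Prop :=
  [/\ idealr_closed p, prime_idealr_closed p
    & exists m : M, forall a, (a \in p) = (a *: m == 0)].

Definition colon (R : comNzRingType) (I : {pred R}) (f : R) : {pred R} :=
  [pred a | a * f \in I].

Definition ideal2 (R : comNzRingType) (x y : R) : {pred R} :=
  [pred f | `[< exists a b : R, f = a * x + b * y >]].

(* Ideals of S are the submodules of the regular module S^o; for a graph
   without edges the empty intersection is S itself. *)
Section CoverIdeal.
Variables (K : fieldType) (G : sgraph).

Definition cover_ideal : {pred {mpoly K[nvert G]}^o} :=
  [pred f | `[< forall i j, @adj G i j -> f \in ideal2 'X_i 'X_j >]].

Lemma cover_ideal_submod_closed : submod_closed cover_ideal.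
Proof.
split=> [|a f g]; first by apply/asboolP=> i j _; apply/asboolP;
  exists 0, 0; rewrite !mul0r addr0.
move=> /asboolP fJ /asboolP gJ; apply/asboolP => i j ij; apply/asboolP.
have /asboolP[b [c ->]] := fJ i j ij; have /asboolP[d [e ->]] := gJ i j ij.
exists (a * b + d), (a * c + e).
by rewrite [_ *: _]mulrDr !mulrDl !mulrA addrACA.
Qed.

HB.instance Definition _ := GRing.isSubmodClosed.Build
  {mpoly K[nvert G]} {mpoly K[nvert G]}^o cover_ideal
  cover_ideal_submod_closed.

End CoverIdeal.

Arguments cover_ideal : clear implicits.

Section VNumber.
Variables (K : fieldType) (n : nat) (I : submodClosed {mpoly K[n]}^o).

Definition v_attained (u : nat) : Prop :=
  exists (f : {mpoly K[n]}) (p : {pred {mpoly K[n]}}),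
    [/\ f \is u.-homog, associated_prime (quotmod I) p & p =i colon I f].

Definition is_vnumber (v : nat) : Prop :=
  v_attained v /\ forall u, v_attained u -> (v <= u)%N.

End VNumber.

(* The degree-d part of S for d in Z, zero when d < 0. *)
Definition homogz (K : fieldType) (n : nat) (d : int) (f : {mpoly K[n]}) :
    Prop :=
  if d is Posz m then f \is m.-homog else f = 0.

(* The image in S / I of the standard grading of S. *)
Definition quot_grading (K : fieldType) (n : nat)
    (I : submodClosed {mpoly K[n]}^o) (d : int) (m : quotmod I) : Prop :=
  exists2 f : {mpoly K[n]}, homogz d f & m = quotmod_pi I f.

(* A sequence of graded free modules of finite rank
     ... -> F_1 -> F_0 -> M,   F_i = \bigoplus_(a < fr_rank i) S(- fr_deg i a),
   whose maps F_(i+1) -> F_i are given by matrices acting on the right of row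
   vectors; the a-th basis vector of F_i has degree [fr_deg i a]. *)
Record free_seq (K : fieldType) (n : nat) (M : lmodType {mpoly K[n]}) :=
  FreeSeq {
  fr_rank : nat -> nat;
  fr_deg : forall i, 'I_(fr_rank i) -> int;
  fr_diff : forall i, 'M[{mpoly K[n]}]_(fr_rank i.+1, fr_rank i);
  fr_aug : {linear 'rV[{mpoly K[n]}]_(fr_rank 0) -> M}
}.

Section Regularity.
Variables (K : fieldType) (n : nat) (M : lmodType {mpoly K[n]}).
(* [gr d] is the degree-d component of M. *)
Variable gr : int -> M -> Prop.

(* All maps are homogeneous of degree 0. *)
Definition fr_graded (F : free_seq M) : Prop :=
  (forall a, gr (fr_deg a) (fr_aug F (delta_mx 0 a))) /\
  (forall i a b, homogz (fr_deg a - fr_deg b) (fr_diff F i a b)).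

Definition fr_exact (F : free_seq M) : Prop :=
  [/\ forall m : M, exists x, fr_aug F x = m,
      forall x, fr_aug F x = 0 <-> exists y, x = y *m fr_diff F 0
    & forall i (x : 'rV_(fr_rank F i.+1)),
        x *m fr_diff F i = 0 <-> exists y, x = y *m fr_diff F i.+1].

(* The image of F_(i+1) lies in m F_i, where m = <x_1, ..., x_n> is the ideal
   of polynomials with zero constant coefficient. *)
Definition fr_minimal (F : free_seq M) : Prop :=
  forall i a b, (fr_diff F i a b)@_0%MM = 0.

Definition minimal_graded_free_resolution (F : free_seq M) : Prop :=
  [/\ fr_graded F, fr_exact F & fr_minimal F].

Definition betti (F : free_seq M) (i : nat) (j : int) : nat :=
  #|[set a : 'I_(fr_rank F i) | fr_deg a == j]|.

(* Minimal graded free resolutions are unique up to isomorphism, so the value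
   r does not depend on the resolution F. *)
Definition is_regularity (r : int) : Prop :=
  exists2 F : free_seq M, minimal_graded_free_resolution F &
    (exists i j, betti F i j != 0%N /\ r = j - i%:Z) /\
    (forall i j, betti F i j != 0%N -> j - i%:Z <= r).

End Regularity.

Definition reg_minus_v (K : fieldType) (G : sgraph) (k : int) : Prop :=
  exists (r : int) (v : nat),
    [/\ is_regularity (quot_grading (I := cover_ideal K G)) r,
        is_vnumber (cover_ideal K G) v
      & r - v%:Z = k].

(* Main.v *)
(** Join two adjacent vertices x and y to further vertices: B is the set of
    other neighbours of x, A that of y, and there are no other edges.  Then
    J = (xy, x prod A, y prod B) has the minimal resolution
    0 -> S(-|A|-2) + S(-|B|-2) -> S(-2) + S(-|A|-1) + S(-|B|-1) -> S,
    so reg (S/J) = max(|A|, |B|).  For w in B the monomial f = y prod (B \ w)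
    gives (J : f) = (x, w), and dually for A.  Conversely, if (J : f) is prime
    and deg f < min(|A|, |B|), then in degrees up to deg f + 1 the ideal J
    coincides with (xy); no variable other than x, y is then in (J : f), so
    x prod A, y prod B in J force x and y into it, hence xy | f, which is absurd.
    So v(J) = min(|A|, |B|).  Disjoint A and B give a bipartite graph, a common
    vertex gives a triangle. *)
Require Import Defs.
From HB Require Import structures.
From mathcomp Require Import all_boot all_order all_algebra.
From mathcomp Require Import zify ring boolp mpoly ring_quotient.
Set Implicit Arguments.
Unset Strict Implicit.
Unset Printing Implicit Defensive.
Import GRing.Theory.
Local Open Scope ring_scope.

(** * Monomials, supports, and ideals generated by two variables *)

Section MonomialIdeals.
Variables (K : fieldType) (n : nat).
Implicit Types (f g : {mpoly K[n]}) (m : 'X_{1..n}) (i j : 'I_n).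

Lemma mpoly_msupp_ind (Q : {mpoly K[n]} -> Prop) f :
  Q 0 -> (forall g h, Q g -> Q h -> Q (g + h)) ->
  (forall c m, m \in msupp f -> Q (c *: 'X_[m])) -> Q f.
Proof.
move=> Q0 QD QX; rewrite (mpolyE f) big_seq.
by apply: big_ind => // m mf; apply: QX.
Qed.

Lemma mpolyX_factor i m : (0 < m i)%N ->
  'X_[m] = 'X_[m - U_(i)] * 'X_i :> {mpoly K[n]}.
Proof.
move=> mi; rewrite -mpolyXD submK //.
by apply/mnm_lepP => l; rewrite mnm1E; case: eqP => [<-|].
Qed.

Lemma mesym1_le m u (C : {set 'I_n}) : (0 < m u)%N ->
  {in C, forall w, 0 < m w}%N -> (mesym1 (u |: C) <= m)%MM.
Proof.
move=> mu mC; apply/mnm_lepP => w; rewrite mnmE !inE.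
by case: eqP => [->|_] //=; case: (boolP (w \in C)) => [/mC|].
Qed.

Lemma mem_msuppMX f m m' :
  m' \in msupp (f * 'X_[m]) -> exists2 m1, m1 \in msupp f & m' = (m1 + m)%MM.
Proof.
rewrite (perm_mem (msuppMX _ _)) => /mapP[m1 m1f ->].
by exists m1 => //; rewrite addmC.
Qed.

Lemma mem_msuppMXD f m m' : m' \in msupp f -> (m' + m)%MM \in msupp (f * 'X_[m]).
Proof.
by move=> h; rewrite (perm_mem (msuppMX _ _)) addmC map_f.
Qed.

(** The ideal is monomial, so membership can be tested on each monomial of [f] separately. *)
Lemma mem_ideal2P f i j :
  f \in ideal2 'X_i 'X_j <->
  {in msupp f, forall m, (0 < m i) || (0 < m j)}%N.
Proof.
split=> [/asboolP[a [b ->]] m /msuppD_le|sf].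
  rewrite mem_cat => /orP[] /mem_msuppMX[m' _ ->];
  by rewrite !mnmDE !mnm1E !eqxx !addn1 ?orbT.
apply: (@mpoly_msupp_ind (fun g => g \in ideal2 'X_i 'X_j)) => [|g h|c m mf].
- by apply/asboolP; exists 0, 0; rewrite !mul0r addr0.
- move=> /asboolP[a [b ->]] /asboolP[c [d ->]]; apply/asboolP.
  by exists (a + c), (b + d); rewrite !mulrDl addrACA.
- apply/asboolP; case/orP: (sf m mf) => /mpolyX_factor ->; rewrite scalerAl.
    by exists (c *: 'X_[m - U_(i)]), 0; rewrite mul0r addr0.
  by exists 0, (c *: 'X_[m - U_(j)]); rewrite mul0r add0r.
Qed.

Lemma mpolyX_dvd f i :
  {in msupp f, forall m, 0 < m i}%N -> exists g, f = g * 'X_i.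
Proof.
(* Repeating the generator turns the two-variable ideal into a principal one. *)
move=> sf; have /asboolP[a [b ->]] : f \in ideal2 'X_i 'X_i.
  by apply/mem_ideal2P => m /sf ->.
by exists (a + b); rewrite mulrDl.
Qed.

(** Substitutes zero for two variables: an endomorphism of a domain, whose kernel will be the ideal
    they generate. *)
Local Notation kill2 i j :=
  (@comp_mpoly n K n
     [tuple if (l == i) || (l == j) then (0 : {mpoly K[n]}) else 'X_l | l < n]).

(** Every monomial of the product contains ['X_i], and ['X_[m]] contributes nothing to that
    exponent. *)
Lemma mpolyX_dvd_mulX f g i m :
  m i = 0%N -> f * 'X_[m] = g * 'X_i -> exists h, f = h * 'X_i.
Proof.
move=> mi fg; apply: mpolyX_dvd => m' m'f.
have := mem_msuppMXD m m'f; rewrite fg => /mem_msuppMX[m1 _ /mnmP/(_ i)].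
by rewrite !mnmDE mi mnm1E eqxx addn0 addn1 => ->.
Qed.

Lemma mpolyX_mesym1U i (C : {set 'I_n}) : i \notin C ->
  'X_[mesym1 (i |: C)] = 'X_i * 'X_[mesym1 C] :> {mpoly K[n]}.
Proof.
move=> iC; rewrite -mpolyXD; congr 'X_[_]; apply/mnmP => l.
rewrite mnmDE mnm1E !mnmE !inE eq_sym.
by case: eqP iC => [<- /negbTE ->|].
Qed.

Lemma kill2X i j m : kill2 i j 'X_[m] =
  if (0 < m i)%N || (0 < m j)%N then 0 else 'X_[m] :> {mpoly K[n]}.
Proof.
rewrite comp_mpolyX.
have [h|/norP[]] := boolP ((0 < m i) || (0 < m j))%N.
  have [l lij ml]: exists2 l, (l == i) || (l == j) & (0 < m l)%N.
    by case/orP: h; [exists i | exists j] => //; rewrite eqxx ?orbT.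
  by rewrite (bigD1 l) //= tnth_mktuple lij expr0n -[_ == _]negbK -lt0n ml mul0r.
rewrite -!eqn0Ngt => /eqP mi /eqP mj; rewrite [RHS]mpolyXE_id.
apply: eq_bigr => l _; rewrite tnth_mktuple.
by have [/orP[] /eqP ->|] := boolP ((l == i) || (l == j)); rewrite ?mi ?mj.
Qed.

Lemma mem_ideal2E f i j : (f \in ideal2 'X_i 'X_j) = (kill2 i j f == 0).
Proof.
apply/idP/eqP => [/asboolP[a [b ->]]|f0].
  by rewrite rmorphD !rmorphM /= !kill2X !mnm1E !eqxx orbT !mulr0 addr0.
(* As [kill2 i j f] is zero, it suffices to put [f - kill2 i j f] in the ideal; this is additive in
   [f], hence a check on monomials. *)
rewrite -[f]subr0 -f0; apply: (@mpoly_msupp_ind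
    (fun g => g - kill2 i j g \in ideal2 'X_i 'X_j)) => [|g h|c m _].
- by apply/asboolP; exists 0, 0; rewrite rmorph0 subr0 !mul0r addr0.
- move=> /asboolP[a [b gE]] /asboolP[c [d hE]]; apply/asboolP.
  exists (a + c), (b + d).
  by rewrite rmorphD opprD addrACA gE hE !mulrDl addrACA.
- rewrite comp_mpolyZ kill2X.
  have [h|_] := boolP ((0 < m i) || (0 < m j))%N.
    by rewrite scaler0 subr0; apply/mem_ideal2P => m' /msuppZ_le;
       rewrite msuppX inE => /eqP ->.
  by rewrite subrr; apply/asboolP; exists 0, 0; rewrite !mul0r addr0.
Qed.

Lemma ideal2_idealr_closed i j : idealr_closed (ideal2 'X_i 'X_j : {pred {mpoly K[n]}}).
Proof.
split=> [||a u v]; rewrite !mem_ideal2E ?rmorph0 ?rmorph1 ?oner_eq0 //.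
by move=> /eqP u0 /eqP v0; rewrite rmorphD rmorphM /= u0 v0 mulr0 addr0.
Qed.

(** The ideal is the kernel of a ring morphism into a domain. *)
Lemma ideal2_prime i j : prime_idealr_closed (ideal2 'X_i 'X_j : {pred {mpoly K[n]}}).
Proof. by move=> u v; rewrite !mem_ideal2E rmorphM mulf_eq0. Qed.

(** Primality first selects one power of a variable in the monomial, then the variable itself. The
    exponent is positive because 1 is not in [p]. *)
Lemma prime_idealr_mpolyX (p : {pred {mpoly K[n]}}) m :
  idealr_closed p -> prime_idealr_closed p -> 'X_[m] \in p ->
  exists2 i, (0 < m i)%N & 'X_i \in p.
Proof.
case=> p0 p1 _ prp; rewrite mpolyXE_id => mp.
have: has (fun i => 'X_i ^+ m i \in p) (index_enum 'I_n).
  move: mp; elim: (index_enum _) => [|i s IH] /=.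
    by rewrite big_nil (negbTE p1).
  by rewrite big_cons => /prp /orP[->|/IH ->]; rewrite ?orbT.
case/hasP => i _; case mi: (m i) => [|e].
  by rewrite /= expr0 (negbTE p1).
move=> h; exists i; first by rewrite mi.
elim: e {mi} h => [|e IH] //.
by rewrite exprS => /prp /orP[|/IH].
Qed.

Lemma homogz_Posz d e f : d = e%:Z -> f \is e.-homog -> homogz d f.
Proof. by move=> ->. Qed.

Lemma homogz0 d : homogz d (0 : {mpoly K[n]}).
Proof. by case: d => //= e; apply: dhomog0. Qed.

End MonomialIdeals.

(** Destructing a sequence of known size names the coordinates of a row vector in the exactness
    computations. *)
Lemma rV_seqP (R : nzRingType) n (v : 'rV[R]_n) :
  exists2 s : seq R, size s = n & v = \row_j s`_j.
Proof.
exists [seq v 0 j | j <- enum 'I_n]; first by rewrite size_map size_enum_ord.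
apply/rowP => j; rewrite mxE (nth_map j) ?size_enum_ord //.
by rewrite nth_ord_enum.
Qed.

Lemma quotmod_pi_eq0 (R : nzRingType) (V : lmodType R) (N : submodClosed V) u :
  (quotmod_pi N u == 0) = (u \in N).
Proof. by rewrite -[0](raddf0 (quotmod_pi N)) quotmod_piE subr0. Qed.

(** * The graph with two adjacent centres *)

Section TwoCenters.
Variables (K : fieldType) (n : nat) (x y : 'I_n) (A B : {set 'I_n}).

(** Edges in one direction only. [bistar_adj] symmetrizes and removes loops, so that the graph
    exists for arbitrary [x], [y], [A] and [B]. *)
Definition bistar_arc : rel 'I_n := fun i j =>
  (i == x) && (j \in y |: B) || (i == y) && (j \in A).

Definition bistar_adj : rel 'I_n := fun i j =>
  (i != j) && (bistar_arc i j || bistar_arc j i).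

Lemma bistar_adj_sym i j : bistar_adj i j = bistar_adj j i.
Proof. by rewrite /bistar_adj eq_sym orbC. Qed.

Lemma bistar_adj_irr i : ~~ bistar_adj i i.
Proof. by rewrite /bistar_adj eqxx. Qed.

Definition bistar := SGraph bistar_adj_sym bistar_adj_irr.

Hypotheses (xy : x != y) (xA : x \notin A) (yA : y \notin A)
           (xB : x \notin B) (yB : y \notin B).

Lemma bistar_adjxy : bistar_adj x y.
Proof. by rewrite /bistar_adj /bistar_arc xy !inE !eqxx. Qed.

Lemma bistar_adjx w : w \in B -> bistar_adj x w.
Proof.
move=> wB; rewrite /bistar_adj /bistar_arc !inE eqxx wB orbT /= andbT.
by apply: contraNneq xB => ->.
Qed.

Lemma bistar_adjy w : w \in A -> bistar_adj y w.
Proof.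
move=> wA; rewrite /bistar_adj /bistar_arc !inE eqxx wA orbT /= andbT.
by apply: contraNneq yA => ->.
Qed.

Lemma bistar_adj_sub (P : rel 'I_n) : ssrbool.symmetric P -> P x y ->
  {in B, forall w, P x w} -> {in A, forall w, P y w} ->
  forall i j, bistar_adj i j -> P i j.
Proof.
move=> symP Pxy PB PA i j /andP[_].
have arcP i' j' : bistar_arc i' j' -> P i' j'.
  case/orP => /andP[/eqP ->]; last exact: PA.
  by rewrite !inE => /orP[/eqP ->|/PB].
by case/orP => /arcP //; rewrite symP.
Qed.

Lemma bistar_connected :
  (forall v, [|| v == x, v == y, v \in A | v \in B]) -> sg_connected bistar.
Proof.
move=> xyAB; split; first exact: leq_ltn_trans (ltn_ord x).
have xv v : connect bistar_adj x v.
  case/or4P: (xyAB v) => [/eqP ->|/eqP ->|vA|vB].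
  - exact: connect0.
  - exact: connect1 bistar_adjxy.
  - exact: connect_trans (connect1 bistar_adjxy) (connect1 (bistar_adjy vA)).
  - exact: connect1 (bistar_adjx vB).
move=> u v; apply: connect_trans (xv v).
by rewrite (sym_connect_sym bistar_adj_sym).
Qed.

Lemma bistar_bipartite : [disjoint A & B] -> sg_bipartite bistar.
Proof.
(* One colour class is [x] with the further neighbours of [y]; [y] and [B] lie in the other. *)
move=> dAB; exists (x |: A).
apply: bistar_adj_sub => [i j||w wB|w wA]; rewrite !inE.
- by rewrite eq_sym.
- by rewrite eqxx (eq_sym y) (negbTE xy) (negbTE yA).
- have /negbTE -> : w \notin A by rewrite (disjointFl dAB).
  by rewrite eqxx; case: (eqVneq w x) wB xB => [->|//] ->.
- by rewrite wA orbT (eq_sym y) (negbTE xy) (negbTE yA).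
Qed.

Lemma bistar_not_bipartite w : w \in A -> w \in B -> ~ sg_bipartite bistar.
Proof.
move=> wA wB [C bip].
have := bip _ _ bistar_adjxy; have := bip _ _ (bistar_adjx wB).
have := bip _ _ (bistar_adjy wA).
by case: (x \in C) (y \in C) (w \in C) => -[] [].
Qed.

(** * Vertex covers and the monomials of the cover ideal *)

Definition covers (m : 'X_{1..n}) : bool :=
  [|| (0 < m x) && (0 < m y),
      (0 < m x) && [forall w in A, 0 < m w]
    | (0 < m y) && [forall w in B, 0 < m w]]%N.

(** The edge between [x] and [y] puts one centre in the support; if the other centre is missing, all
    neighbours of that other centre must be present. *)
Lemma coversP (m : 'X_{1..n}) :
  reflect (forall i j, bistar_adj i j -> (0 < m i) || (0 < m j))%N (covers m).
Proof.
apply: (iffP idP) => [cm|cov].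
  apply: bistar_adj_sub => [i j|||]; first by rewrite orbC.
  - by case/or3P: cm => /andP[-> //]; rewrite orbT.
  - move=> w wB; case/or3P: cm => /andP[mx]; rewrite ?mx //.
    by move/forall_inP => /(_ w wB) ->; rewrite orbT.
  - move=> w wA; case/or3P: cm => /andP[mx]; rewrite ?mx //; first by move=> ->.
    by move/forall_inP => /(_ w wA) ->; rewrite orbT.
rewrite /covers; have := cov _ _ bistar_adjxy.
case: (posnP (m x)) => [mx /= my|mx _].
  rewrite my /=; apply/forall_inP => w /bistar_adjx /cov.
  by rewrite mx.
case: (posnP (m y)) => [my|//]; rewrite /= orbF.
by apply/forall_inP => w /bistar_adjy /cov; rewrite my.
Qed.

Lemma mem_cover_idealP (f : {mpoly K[n]}) :
  f \in cover_ideal K bistar <-> {in msupp f, forall m, covers m}.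
Proof.
split=> [/asboolP fJ m mf|cf].
  by apply/coversP => i j /fJ/mem_ideal2P; apply.
apply/asboolP => i j ij; apply/mem_ideal2P => m /cf/coversP; exact.
Qed.

(** A cover missing one centre contains the other centre and all of [A] or all of [B], hence has
    more vertices than the smaller of these sets. *)
Lemma covers_mdeg (m : 'X_{1..n}) : covers m ->
  (0 < m x)%N && (0 < m y)%N || (minn #|A| #|B| < mdeg m)%N.
Proof.
have count u (C : {set 'I_n}) : u \notin C -> (0 < m u)%N ->
    [forall w in C, 0 < m w]%N -> (#|C| < mdeg m)%N.
  move=> uC mu /forall_inP mC; rewrite -(submK (mesym1_le mu mC)).
  by rewrite mdegD mdeg_mesym1 cardsU1 uC leq_addl.
case/or3P => [->//|/andP[mx mA]|/andP[my mB]]; apply/orP; right.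
  by rewrite gtn_min [X in X || _](count x).
by rewrite gtn_min [X in _ || X](count y) ?orbT.
Qed.

(** * The v-number of the cover ideal *)

Lemma covers_mul_mem (m : 'X_{1..n}) (g : {mpoly K[n]}) :
  covers m -> g * 'X_[m] \in cover_ideal K bistar.
Proof.
move=> cm; apply/mem_cover_idealP => _ /mem_msuppMX[m' _ ->].
apply/coversP => i j /(coversP _ cm); rewrite !mnmDE !addn_gt0.
by case/orP => ->; rewrite ?orbT.
Qed.

(** The product has degree at most the smaller cardinality, so both centres divide each of its
    monomials. The terms [(w == x)] and [(w == y)] account for the factor ['X_w]. *)
Lemma mulX_cover_ideal u w (f : {mpoly K[n]}) : f \is u.-homog ->
  (u < minn #|A| #|B|)%N -> 'X_w * f \in cover_ideal K bistar ->
  {in msupp f, forall m : 'X_{1..n}, (0 < m x + (w == x)) && (0 < m y + (w == y))}%N.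
Proof.
move=> /dhomogP fu ltu /mem_cover_idealP cwf m mf.
have /cwf/covers_mdeg/orP[|] : (m + U_(w))%MM \in msupp ('X_w * f).
  by rewrite mulrC mem_msuppMXD.
  by rewrite !mnmDE !mnm1E.
by rewrite mdegD mdeg1 (fu m mf) addn1 ltnNge ltu.
Qed.

Lemma bistar_v_ge u :
  v_attained (cover_ideal K bistar) u -> (minn #|A| #|B| <= u)%N.
Proof.
case=> f [p [fu [idp prp _] pE]]; rewrite leqNgt; apply/negP => ltu.
have fNJ : f \notin cover_ideal K bistar.
  by case: idp => _ p1 _; move: p1; rewrite pE inE mul1r.
have pw w : 'X_w \in p ->
    {in msupp f, forall m : 'X_{1..n}, (0 < m x + (w == x)) && (0 < m y + (w == y))}%N.
  by rewrite pE; apply: mulX_cover_ideal fu ltu.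
have pXm m : covers m -> exists2 i, (0 < m i)%N & 'X_i \in p.
  move=> cm; apply: prime_idealr_mpolyX => //; rewrite pE inE mulrC.
  exact: covers_mul_mem.
have NpXw w : w != x -> w != y -> 'X_w \notin p.
  move=> /negbTE wx /negbTE wy; apply: contra fNJ => /pw fw.
  apply/mem_cover_idealP => m /fw; rewrite wx wy !addn0 /covers => -> //.
(* The monomial on [v] and [C] lies in [p], hence so does one of its variables; those indexed by [C]
   are excluded by [NpXw]. *)
have sub_p v (C : {set 'I_n}) : v \notin C -> x \notin C -> y \notin C ->
    covers (mesym1 (v |: C)) -> 'X_v \in p.
  move=> vC xC yC /pXm[w]; rewrite mnmE !inE.
  case: eqP => [->//|_] /=; case: (boolP (w \in C)) => // wC _ pw'.
  suff: 'X_w \notin p by rewrite pw'.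
  apply: NpXw.
    by apply: contraNneq xC => <-.
  by apply: contraNneq yC => <-.
have px : 'X_x \in p.
  apply: (sub_p x A) => //; rewrite /covers !mnmE !inE eqxx /=.
  apply/orP; right; apply/orP; left.
  by apply/forall_inP => w wA; rewrite mnmE !inE wA orbT.
have py : 'X_y \in p.
  apply: (sub_p y B) => //; rewrite /covers !mnmE !inE eqxx /=.
  apply/orP; right; apply/orP; right.
  by apply/forall_inP => w wB; rewrite mnmE !inE wB orbT.
case/negP: fNJ; apply/mem_cover_idealP => m mf; rewrite /covers.
have := pw _ px _ mf; have := pw _ py _ mf.
by rewrite !eqxx (negbTE xy) eq_sym (negbTE xy) !addn0 => /andP[-> _] /andP[_ ->].
Qed.

Lemma bistar_v_attained :
  (0 < #|B|)%N -> v_attained (cover_ideal K bistar) #|B|.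
Proof.
case/card_gt0P => w wB; pose f : {mpoly K[n]} := 'X_[mesym1 (y |: B :\ w)].
have wx : w != x by apply: contraNneq xB => <-.
have wy : w != y by apply: contraNneq yB => <-.
have colonE g : (g \in ideal2 'X_x 'X_w) = (g * f \in cover_ideal K bistar).
  apply/idP/idP => [/mem_ideal2P gxw|/mem_cover_idealP cgf].
    apply/mem_cover_idealP => _ /mem_msuppMX[m /gxw mxw ->].
    rewrite /covers !mnmDE !mnmE !inE eqxx !addn1 /=.
    case/orP: mxw => [mx|mw]; first by rewrite addn_gt0 mx.
    apply/orP; right; apply/orP; right; apply/forall_inP => l lB.
    rewrite mnmDE mnmE !inE lB.
    by case: (eqVneq l w) => [->|_]; rewrite ?orbT ?addn1 // addn_gt0 mw.
  (* Neither [x] nor [w] occurs in [f]. A cover contains [x] or all of [B], in particular [w], and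
     that vertex must come from the monomial [m] of [g]. *)
  apply/mem_ideal2P => m /(mem_msuppMXD (mesym1 (y |: B :\ w)))/cgf.
  rewrite /covers !mnmDE !mnmE !inE (negbTE xy) (negbTE xB) andbF addn0.
  case/or3P => /andP[]; try by move=> ->.
  move=> _ /forall_inP /(_ w wB).
  by rewrite mnmDE mnmE !inE (negbTE wy) eqxx addn0 => ->; rewrite orbT.
exists f, (ideal2 'X_x 'X_w); split=> //.
- rewrite dhomogX; apply/eqP; rewrite [LHS]mdeg_mesym1 cardsU1 !inE.
  by rewrite (negbTE yB) andbF [in RHS](cardsD1 w) wB.
- split; [exact: ideal2_idealr_closed | exact: ideal2_prime|].
  exists (quotmod_pi (cover_ideal K bistar) f) => a.
  by rewrite -linearZ quotmod_pi_eq0 colonE.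
Qed.

(** * Generators and syzygies of the cover ideal *)

Local Notation S := {mpoly K[n]}.
Local Notation J := (cover_ideal K bistar).
Local Notation PA := ('X_[mesym1 A] : S).
Local Notation PB := ('X_[mesym1 B] : S).

(** The three disjuncts of [covers] say which generator divides a given monomial. *)
Lemma cover_ideal_gens (f : S) : f \in J <->
  exists u v w, f = u * ('X_x * 'X_y) + v * ('X_x * PA) + w * ('X_y * PB).
Proof.
have xy' : x \notin [set y] by rewrite inE.
have Exy : 'X_x * 'X_y = 'X_[mesym1 (x |: [set y])] :> S.
  by rewrite mpolyX_mesym1U // mesym1_set1.
rewrite Exy -!mpolyX_mesym1U //; split; last first.
  case=> u [v [w ->]]; rewrite !(rpredD (S := J)) ?covers_mul_mem // /covers.
  - by rewrite !mnmE !inE !eqxx orbT.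
  - apply/orP; right; apply/orP; left; rewrite mnmE !inE eqxx.
    by apply/forall_inP => l lA; rewrite mnmE !inE lA orbT.
  - apply/orP; right; apply/orP; right; rewrite mnmE !inE eqxx.
    by apply/forall_inP => l lB; rewrite mnmE !inE lB orbT.
move/mem_cover_idealP => cf.
apply: (@mpoly_msupp_ind _ _ (fun f => exists u v w, f = u * _ + v * _ + w * _)).
- by exists 0, 0, 0; rewrite !mul0r !addr0.
- move=> _ _ [u [v [w ->]]] [u' [v' [w' ->]]].
  exists (u + u'), (v + v'), (w + w').
  ring.
- have divX c (m m' : 'X_{1..n}) : (m' <= m)%MM ->
    c *: 'X_[m] = (c *: 'X_[m - m']) * 'X_[m'] :> S.
    by move=> le; rewrite -scalerAl -mpolyXD submK.
  move=> c m /cf /or3P[/andP[mx my]|/andP[mx mA]|/andP[my mB]].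
  + exists (c *: 'X_[m - mesym1 (x |: [set y])]), 0, 0.
    rewrite !mul0r !addr0; apply/divX/mesym1_le => // l.
    by rewrite inE => /eqP ->.
  + exists 0, (c *: 'X_[m - mesym1 (x |: A)]), 0.
    by rewrite !mul0r add0r addr0; apply/divX/mesym1_le => //; apply/forall_inP.
  + exists 0, 0, (c *: 'X_[m - mesym1 (y |: B)]).
    by rewrite !mul0r !add0r; apply/divX/mesym1_le => //; apply/forall_inP.
Qed.

(** ['X_x] divides the first two terms but not ['X_y * PB], so it divides [w]; likewise ['X_y]
    divides [v]. Cancelling ['X_x * 'X_y] then determines [u]. *)
Lemma cover_ideal_syz (u v w : S) :
  u * ('X_x * 'X_y) + v * ('X_x * PA) + w * ('X_y * PB) = 0 ->
  exists h k, [/\ u = - h * PA - k * PB, v = h * 'X_y & w = k * 'X_x].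
Proof.
move=> syz.
have [k wE] : exists k, w = k * 'X_x.
  apply: (@mpolyX_dvd_mulX _ _ _ (- (u * 'X_y + v * PA)) _ (U_(y) + mesym1 B)%MM).
    by rewrite mnmDE mnm1E mnmE eq_sym (negbTE xy) (negbTE xB).
  rewrite mpolyXD; apply/eqP; rewrite -subr_eq0 -[X in _ == X]syz.
  apply/eqP; ring.
have [h vE] : exists h, v = h * 'X_y.
  apply: (@mpolyX_dvd_mulX _ _ _ (- (u * 'X_x + w * PB)) _ (U_(x) + mesym1 A)%MM).
    by rewrite mnmDE mnm1E mnmE (negbTE xy) (negbTE yA).
  rewrite mpolyXD; apply/eqP; rewrite -subr_eq0 -[X in _ == X]syz.
  apply/eqP; ring.
exists h, k; split=> //.
have X0 l : 'X_l != 0 :> S by rewrite -msupp_eq0 msuppX.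
apply: (mulIf (mulf_neq0 (X0 x) (X0 y))); apply/eqP.
rewrite -subr_eq0 -[X in _ == X]syz wE vE; apply/eqP; ring.
Qed.

(** * The minimal graded free resolution and the regularity *)

Local Notation a := #|A|.
Local Notation b := #|B|.

(** The ranks are the sizes of these lists, so they compute to numerals and matrix products expand
    into explicit sums. *)
Definition bistar_degs (i : nat) : seq nat :=
  match i with
  | 0 => [:: 0] | 1 => [:: 2; a.+1; b.+1] | 2 => [:: a.+2; b.+2] | _ => [::]
  end%N.

Definition bistar_deg i (c : 'I_(size (bistar_degs i))) : int :=
  (nth 0 (bistar_degs i) c)%N%:Z.

(** Rows are images of basis vectors. For [i = 1] they are the syzygies of [cover_ideal_syz] with
    (h, k) equal to (1, 0) and (0, 1). *)
Definition bistar_diff_seq (i : nat) : seq (seq S) :=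
  match i with
  | 0%N => [:: [:: 'X_x * 'X_y]; [:: 'X_x * PA]; [:: 'X_y * PB]]
  | 1%N => [:: [:: - PA; 'X_y; 0]; [:: - PB; 0; 'X_x]]
  | _ => [::]
  end.

Definition bistar_diff i :
    'M[S]_(size (bistar_degs i.+1), size (bistar_degs i)) :=
  \matrix_(r, c) (nth [::] (bistar_diff_seq i) r)`_c.

Definition bistar_aug (v : 'rV[S]_(size (bistar_degs 0))) : quotmod J :=
  quotmod_pi J (v 0 ord0).

Lemma bistar_aug_linear : linear bistar_aug.
Proof.
by move=> c u v; rewrite /bistar_aug !mxE raddfD /= -linearZ.
Qed.

HB.instance Definition _ :=
  GRing.isLinear.Build S 'rV[S]_(size (bistar_degs 0)) (quotmod J) *:%R
    bistar_aug bistar_aug_linear.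

Definition bistar_res : free_seq (quotmod J) :=
  FreeSeq bistar_deg bistar_diff bistar_aug.

Lemma bistar_res_graded : fr_graded (quot_grading (I := J)) bistar_res.
Proof.
have hX i : ('X_i : S) \is 1.-homog by rewrite dhomogX; apply/eqP/mdeg1.
have hE C : ('X_[mesym1 C] : S) \is #|C|.-homog.
  by rewrite dhomogX; apply/eqP/mdeg_mesym1.
split=> [c|[|[|i]] [r ltr] [c ltc]] /=.
- exists 1; last by rewrite /bistar_aug mxE !ord1.
  by rewrite ord1; apply: dhomog1.
- rewrite mxE /bistar_deg /=; case: c ltc => //= ltc.
  case: r ltr => [|[|[|r]]] //= ltr.
  + by rewrite addn0; exact: (dhomogM (hX x) (hX y)).
  + by rewrite addn0; exact: (dhomogM (hX x) (hE A)).
  + by rewrite addn0; exact: (dhomogM (hX y) (hE B)).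
- rewrite mxE /bistar_deg.
  case: r ltr => [|[|r]] ltr //; case: c ltc => [|[|[|c]]] ltc //;
  try exact: homogz0.
  + by apply: (@homogz_Posz _ _ _ a) => /=; [lia | rewrite dhomogN].
  + by apply: (@homogz_Posz _ _ _ 1) => /=; [lia | ].
  + by apply: (@homogz_Posz _ _ _ b) => /=; [lia | rewrite dhomogN].
  + by apply: (@homogz_Posz _ _ _ 1) => /=; [lia | ].
- by [].
Qed.

Lemma bistar_res_exact : fr_exact bistar_res.
Proof.
have X0 l : 'X_l != 0 :> S by rewrite -msupp_eq0 msuppX.
split=> [m|v|[|[|i]] v] /=.
- have [f <-] := quotmod_pi_surj m.
  by exists (\row__ f); rewrite /bistar_aug mxE.
- have [[|f []] //= _ ->] := rV_seqP v; rewrite /bistar_aug mxE /=.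
  split=> [/eqP|[z]].
    rewrite quotmod_pi_eq0 => /cover_ideal_gens[u [w [t ->]]].
    exists (\row_j [:: u; w; t]`_j); apply/rowP => c.
    by rewrite !mxE !big_ord_recl !big_ord0 !mxE /= ord1 /= addr0 addrA.
  have [[|u [|w [|t []]]] //= _ ->] := rV_seqP z.
  move/rowP/(_ ord0); rewrite !mxE !big_ord_recl !big_ord0 !mxE /= addr0 addrA.
  move=> ->; apply/eqP; rewrite quotmod_pi_eq0; apply/cover_ideal_gens.
  by exists u, w, t.
- have [[|u [|w [|t []]]] //= _ ->] := rV_seqP v.
  split=> [/rowP/(_ ord0)|[z]].
    rewrite !mxE !big_ord_recl !big_ord0 !mxE /= addr0 addrA.
    move=> /cover_ideal_syz[h [k [-> -> ->]]].
    exists (\row_j [:: h; k]`_j); apply/rowP => -[[|[|[|c]]] //= ltc];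
    rewrite !mxE !big_ord_recl !big_ord0 !mxE /=; ring.
  have [[|h [|k []]] //= _ ->] := rV_seqP z.
  move=> /rowP vE; apply/rowP => c; rewrite (ord1 c).
  move: (vE 0) (vE 1) (vE 2%:R).
  rewrite !mxE !big_ord_recl !big_ord0 !mxE /= => -> -> ->.
  ring.
- have [[|u [|w []]] //= _ ->] := rV_seqP v.
  split=> [/rowP vE|[z ->]].
    (* Coordinates 1 and 2 of the image are [u * 'X_y] and [w * 'X_x]; their vanishing forces [u]
       and [w] to vanish, so the last map is injective. *)
    exists 0; rewrite mul0mx; move: (vE 1) (vE 2%:R).
    rewrite !mxE !big_ord_recl !big_ord0 !mxE /= !(mulr0, add0r, addr0).
    move=> /eqP; rewrite mulf_eq0 (negbTE (X0 y)) orbF => /eqP ->.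
    move=> /eqP; rewrite mulf_eq0 (negbTE (X0 x)) orbF => /eqP ->.
    by apply/rowP => -[[|[|c]] ltc] //=; rewrite !mxE.
  have -> : z = 0 by apply/rowP => -[].
  by rewrite !mul0mx.
- have -> : v = 0 by apply/rowP => -[].
  by split=> _; [exists 0; rewrite mul0mx | rewrite mul0mx].
Qed.

(** All nonzero entries are monomials up to sign; nonempty [A] and [B] keep [PA] and [PB] from being
    1. *)
Lemma bistar_res_minimal : (0 < a)%N -> (0 < b)%N -> fr_minimal bistar_res.
Proof.
have c0 (m : 'X_{1..n}) : (0 < mdeg m)%N -> ('X_[m] : S)@_0%MM = 0.
  by move=> dm; rewrite mcoeffX -mdeg_eq0 eqn0Ngt dm.
move=> a0 b0 [|[|i]] [r ltr] [c ltc] /=.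
- rewrite mxE; case: c ltc => //= ltc.
  by case: r ltr => [|[|[|r]]] //= ltr; rewrite -mpolyXD c0 // mdegD mdeg1.
- rewrite mxE; case: r ltr => [|[|r]] //= ltr.
    case: c ltc => [|[|[|c]]] //= ltc; rewrite ?mcoeff0 ?mcoeffN ?c0 ?oppr0 //.
      by rewrite mdeg_mesym1.
    by rewrite mdeg1.
  case: c ltc => [|[|[|c]]] //= ltc; rewrite ?mcoeff0 ?mcoeffN ?c0 ?oppr0 //.
    by rewrite mdeg_mesym1.
  by rewrite mdeg1.
- by [].
Qed.

(** Internal minus homological degree takes the values 0, then 1, [a], [b], then [a], [b], and here
    1 <= b <= a. *)
Lemma bistar_regularity : (0 < b)%N -> (b <= a)%N ->
  is_regularity (quot_grading (I := J)) a.
Proof.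
move=> b0 ba; exists bistar_res.
  split; [exact: bistar_res_graded | exact: bistar_res_exact|].
  by apply: bistar_res_minimal => //; apply: leq_trans ba.
split=> [|i j].
  (* The maximum is reached at the generator ['X_x * PA], which has index 1 in homological degree
     1. *)
  exists 1%N, (a.+1)%:Z; split; last lia.
  by rewrite -lt0n; apply/card_gt0P; exists (1 : 'I_3); rewrite inE.
rewrite -lt0n => /card_gt0P[c]; rewrite inE => /eqP <- {j}.
have subz_le (d e : nat) : (d <= e + a)%N -> d%:Z - e%:Z <= a%:Z by lia.
case: i c => [|[|[|i]]] [c ltc] //; apply: subz_le;
  case: c ltc => [|[|[|c]]] ltc //=; rewrite ?add1n ?add2n ?ltnS //.
exact: leq_trans ba.
Qed.

Lemma bistar_reg_minus_v : (0 < b)%N -> (b <= a)%N ->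
  reg_minus_v K bistar (a - b)%N.
Proof.
move=> b0 ba; exists a, b; split.
- exact: bistar_regularity.
- split; first exact: bistar_v_attained.
  by move=> u /bistar_v_ge; rewrite (minn_idPr ba).
- lia.
Qed.

End TwoCenters.

(** * Explicit graphs given by intervals of vertices *)

Definition ord_interval n l u : {set 'I_n} := [set i : 'I_n | l <= i < u]%N.

Lemma card_ord_interval n l u : (u <= n)%N -> #|ord_interval n l u| = (u - l)%N.
Proof.
move=> un; rewrite cardsE -sum1_card.
rewrite -(big_ord_widen_cond _ (fun i => l <= i)%N (fun=> 1%N)) //.
transitivity (\sum_(l <= i < u) 1)%N; last by rewrite sum_nat_const_nat muln1.
by rewrite big_geq_mkord.
Qed.

(** Vertices 0 and 1 are the centres. For 2 <= l <= u <= m + 2 the two intervals cover the remaining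
    vertices and meet exactly in those from [l] to [u - 1]. *)
Definition interval_bistar m l u : sgraph :=
  @bistar m.+2 ord0 (lift ord0 ord0)
    (ord_interval m.+2 l m.+2) (ord_interval m.+2 2 u).

(** The sets have [m + 2 - l] and [u - 2] elements, so the equation makes [k] their difference;
    [l <= u] attaches every vertex to a centre. *)
Lemma interval_bistarP (K : fieldType) m l u k :
  (2 <= l)%N -> (l <= u)%N -> (2 < u)%N -> (u + l + k = m + 4)%N ->
  sg_connected (interval_bistar m l u) /\ reg_minus_v K (interval_bistar m l u) k.
Proof.
move=> l2 lu u2 um.
have cA : #|ord_interval m.+2 l m.+2| = (m.+2 - l)%N by rewrite card_ord_interval.
have cB : #|ord_interval m.+2 2 u| = (u - 2)%N by rewrite card_ord_interval //; lia.
have -> : k = (#|ord_interval m.+2 l m.+2| - #|ord_interval m.+2 2 u|)%N.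
  by rewrite cA cB; lia.
split; last first.
  by apply: bistar_reg_minus_v; rewrite ?cA ?cB ?inE /= /bump /=; lia.
apply: bistar_connected; rewrite ?inE /= /bump /=; try lia.
move=> v; rewrite -!val_eqE !inE /= /bump /=; have := ltn_ord v; lia.
Qed.

Theorem theorem1p5 (K : fieldType) (k : nat) (k_gt0 : (0 < k)%N) :
  (exists H : nat -> sgraph,
     (forall s t : nat, sg_iso (H s) (H t) -> s = t) /\
     (forall t : nat, sg_connected (H t) /\ sg_bipartite (H t) /\
                      reg_minus_v K (H t) k)) /\
  (exists H : sgraph,
     sg_connected H /\ ~ sg_bipartite H /\ reg_minus_v K H k).
Proof.
split.
  (* Equal bounds make the sets disjoint, of sizes [t + k + 1] and [t + 1]. The [2t + k + 4]
     vertices determine [t]. *)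
  exists (fun t => interval_bistar (t.*2 + k + 2) (t + 3) (t + 3)); split.
    by move=> s t [f [/bij_eq_card]]; rewrite !card_ord /=; lia.
  move=> t; have [||||cn rv] :=
    @interval_bistarP K (t.*2 + k + 2) (t + 3) (t + 3) k; try lia.
  split=> //; split=> //; apply: bistar_bipartite; rewrite ?inE /= /bump /=; try lia.
  by rewrite -setI_eq0; apply/eqP/setP => i; rewrite !inE; lia.
(* The smaller set is {2} and lies in the larger one, of size [k + 1]; vertices 0, 1 and 2 form a
   triangle. *)
exists (interval_bistar k.+1 2 3).
have [||||cn rv] := @interval_bistarP K k.+1 2 3 k; try lia.
split=> //; split=> //.
apply: (@bistar_not_bipartite _ _ _ _ _ _ _ _ (inord 2));
  rewrite ?inE ?inordK /= /bump //=; lia.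
Qed.
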